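(* Let $G$ be a graph on $n$ vertices and let $I=J(\widetilde G)$ be the cover ideal of the whiskering $\widetilde G$ of $G$. The analytic spread of $I$ is $l(I)=n+1$.
   Context: All graphs are finite and simple. Given a graph $G$ with vertices $x_1,\dots,x_n$, its whiskering $\widetilde G$ is the graph with vertex set $\{x_1,\dots,x_n,y_1,\dots,y_n\}$ and edge set $E(G)\cup\{\{x_i,y_i\}: i=1,\dots,n\}$. Vertices are identified with variables of a polynomial ring $R$ over a field $k$; the cover ideal of a graph $H$ is $J(H)=\bigcap_{\{u,v\}\in E(H)}(u,v)\subseteq R$. The fiber cone of an ideal $I$ is $F(I)=\bigoplus_{i\ge0}I^i/\mathfrak m I^i$, with $\mathfrak m$ the homogeneous maximal ideal of $R$, and the analytic spread $l(I)$ is the Krull dimension of $F(I)$. *)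

(* Defs.v *)
From HB Require Import structures.
From mathcomp Require Import all_boot all_order all_algebra ring_quotient.
From mathcomp Require Import boolp mpoly.

Set Implicit Arguments.
Unset Strict Implicit.
Unset Printing Implicit Defensive.
Import GRing.Theory.
Local Open Scope ring_scope.

(* Ideals are boolean predicates; their membership is decided classically
   through `[< _ >]. The library's [idealr_closed] only covers proper ideals,
   whereas I ^ 0 and the cover ideal of an edgeless graph are the unit ideal. *)

Section Ideals.
Variable R : comNzRingType.
Implicit Types (S I J : {pred R}) (x : R).

Definition ideal_gen S : {pred R} := fun x =>
  `[< exists2 s : seq (R * R), (forall c, c \in s -> c.2 \in S)
        & x = \sum_(c <- s) c.1 * c.2 >].

Definition ideal_mul I J : {pred R} :=
  ideal_gen (fun x => `[< exists a b, [/\ a \in I, b \in J & x = a * b] >]).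

Fixpoint ideal_exp I (i : nat) : {pred R} :=
  if i is j.+1 then ideal_mul I (ideal_exp I j) else predT.

Lemma ideal_genP S x :
  reflect (exists2 s : seq (R * R), (forall c, c \in s -> c.2 \in S)
             & x = \sum_(c <- s) c.1 * c.2) (x \in ideal_gen S).
Proof. exact: asboolP. Qed.

Lemma mem_ideal_gen S x : x \in S -> x \in ideal_gen S.
Proof.
move=> Sx; apply/ideal_genP; exists [:: (1, x)]; last by rewrite big_seq1 mul1r.
by move=> c /[!inE] /eqP->.
Qed.

Lemma ideal_gen0 S : 0 \in ideal_gen S.
Proof. by apply/ideal_genP; exists [::]; rewrite ?big_nil. Qed.

Lemma ideal_genD S x y :
  x \in ideal_gen S -> y \in ideal_gen S -> x + y \in ideal_gen S.
Proof.
move=> /ideal_genP[s Ss ->] /ideal_genP[t St ->]; apply/ideal_genP.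
exists (s ++ t); last by rewrite big_cat.
by move=> c; rewrite mem_cat => /orP[/Ss|/St].
Qed.

Lemma ideal_genM S a x : x \in ideal_gen S -> a * x \in ideal_gen S.
Proof.
move=> /ideal_genP[s Ss ->]; apply/ideal_genP.
exists [seq (a * c.1, c.2) | c <- s]; first by move=> c /mapP[d /Ss ? ->].
by rewrite big_map mulr_sumr; apply: eq_bigr => c _; rewrite mulrA.
Qed.

Lemma ideal_gen_sum S (T : Type) (r : seq T) (P : pred T) (F : T -> R) :
  (forall i, P i -> F i \in ideal_gen S) ->
  \sum_(i <- r | P i) F i \in ideal_gen S.
Proof.
move=> SF; apply: (big_ind (fun x => x \in ideal_gen S)) => //.
  exact: ideal_gen0.
exact: ideal_genD.
Qed.

Lemma ideal_gen_min S (I : {pred R}) :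
  0 \in I -> (forall x y, x \in I -> y \in I -> x + y \in I) ->
  (forall a x, x \in I -> a * x \in I) ->
  {subset S <= I} -> {subset ideal_gen S <= I}.
Proof.
move=> I0 ID IM sSI x /ideal_genP[s Ss ->]; rewrite big_seq.
by apply: (big_ind (fun x => x \in I)) => // c /Ss /sSI; apply: IM.
Qed.

Lemma mem_ideal_mul I J a b : a \in I -> b \in J -> a * b \in ideal_mul I J.
Proof.
by move=> Ia Jb; apply: mem_ideal_gen; apply/asboolP; exists a, b.
Qed.

Lemma ideal_exp_ideal I i :
  [/\ 0 \in ideal_exp I i,
      forall x y, x \in ideal_exp I i -> y \in ideal_exp I i ->
        x + y \in ideal_exp I i
    & forall a x, x \in ideal_exp I i -> a * x \in ideal_exp I i].
Proof.
case: i => [|i] //=; split; first exact: ideal_gen0.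
  exact: ideal_genD.
exact: ideal_genM.
Qed.

Lemma ideal_expM I i j x y : x \in ideal_exp I i -> y \in ideal_exp I j ->
  x * y \in ideal_exp I (i + j).
Proof.
have [e0 eD eM] := ideal_exp_ideal I j.
elim: i x => [|i IHi] x /= Ix Iy; first exact: eM.
suff: x \in [pred x | x * y \in ideal_exp I (i + j).+1] by [].
apply: ideal_gen_min Ix.
- by rewrite inE mul0r ideal_gen0.
- by move=> u v; rewrite !inE mulrDl; apply: ideal_genD.
- by move=> a u; rewrite !inE -mulrA; apply: ideal_genM.
move=> _ /asboolP[a [b [Ia Ib ->]]].
by rewrite inE -mulrA; apply: mem_ideal_mul => //; apply: IHi.
Qed.

End Ideals.

Section FiberCone.
Variables (k : fieldType) (N : nat).
Local Notation R := {mpoly k[N]}.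

Definition hmax_ideal : {pred R} :=
  ideal_gen (fun p => [exists i : 'I_N, p == 'X_i]).

Lemma hmax_ideal_coef0 (p : R) : p \in hmax_ideal -> p@_0%MM = 0.
Proof.
move=> mp; apply/eqP.
suff: p \in [pred p : R | p@_0%MM == 0] by [].
apply: ideal_gen_min mp => [|u v|a u|_ /existsP[i /eqP->]]; rewrite !inE.
- by rewrite mcoeff0.
- by rewrite mcoeffD => /eqP-> /eqP->; rewrite addr0.
- by rewrite rmorphM /= => /eqP->; rewrite mulr0.
by rewrite mcoeffX mnm1_eq0.
Qed.

Variable I : {pred R}.

(* The direct sum of the I ^ i, as the subring of R[t] formed by the
   polynomials whose coefficient of t ^ i lies in I ^ i. *)
Definition rees_pred : {pred {poly R}} :=
  fun p => `[< forall i, p`_i \in ideal_exp I i >].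

Lemma rees_subring : subring_closed rees_pred.
Proof.
have eN i x : x \in ideal_exp I i -> - x \in ideal_exp I i.
  by have [_ _ eM] := ideal_exp_ideal I i => /(eM (-1)); rewrite mulN1r.
split=> [|p q /asboolP Ip /asboolP Iq|p q /asboolP Ip /asboolP Iq];
  apply/asboolP => i; have [e0 eD _] := ideal_exp_ideal I i.
- by rewrite coef1; case: i e0 {eD} => // i e0; rewrite eqxx.
- by rewrite coefB; apply: eD => //; apply: eN.
rewrite coefM; apply: (big_ind (fun x => x \in ideal_exp I i)) => // j _.
by rewrite -[in ideal_exp I i](subnKC (ltn_ord j : (j <= i)%N)) ideal_expM.
Qed.

HB.instance Definition _ :=
  GRing.isSubringClosed.Build {poly R} rees_pred rees_subring.

Record rees := Rees { rees_val :> {poly R}; _ : rees_val \in rees_pred }.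
HB.instance Definition _ := [isSub for rees_val].
HB.instance Definition _ := [Choice of rees by <:].
HB.instance Definition _ := [SubChoice_isSubComNzRing of rees by <:].

(* The direct sum of the m I ^ i. *)
Definition fiber_ideal : {pred rees} :=
  fun p => `[< forall i, (val p)`_i \in ideal_mul hmax_ideal (ideal_exp I i) >].

Lemma fiber_idealr_closed : idealr_closed fiber_ideal.
Proof.
split.
- by apply/asboolP => i; rewrite rmorph0 coef0 ideal_gen0.
- apply/asboolP => /(_ 0%N); rewrite rmorph1 coef1 /= => m1.
  have /hmax_ideal_coef0/eqP : (1 : R) \in hmax_ideal.
    apply: ideal_gen_min m1; [exact: ideal_gen0|exact: ideal_genD|
      exact: ideal_genM|].
    by move=> _ /asboolP[a [b [ma _ ->]]]; rewrite mulrC; apply: ideal_genM.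
  by rewrite mcoeff1 eqxx oner_eq0.
move=> a p q /asboolP mp /asboolP mq; apply/asboolP => i.
rewrite rmorphD rmorphM coefD; apply: ideal_genD => //.
rewrite coefM; apply: ideal_gen_sum => j _.
move: (valP a) => /asboolP /(_ j) aj; move: (mp (i - j)%N).
set x := (val p)`_(i - j) => mx.
suff: x \in [pred x | (val a)`_j * x
                \in ideal_mul hmax_ideal (ideal_exp I i)] by [].
apply: ideal_gen_min mx.
- by rewrite inE mulr0 ideal_gen0.
- by move=> u v; rewrite !inE mulrDr; apply: ideal_genD.
- by move=> c u; rewrite !inE mulrCA; apply: ideal_genM.
move=> _ /asboolP[c [b [mc Ib ->]]]; rewrite inE mulrCA.
apply: mem_ideal_mul => //.
by rewrite -[in ideal_exp I i](subnKC (ltn_ord j : (j <= i)%N)) ideal_expM.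
Qed.

HB.instance Definition _ :=
  isIdealr.Build rees fiber_ideal fiber_idealr_closed.

Definition fiber_cone : comNzRingType := {ideal_quot fiber_ideal}.

End FiberCone.

Definition prime_ideal (A : comNzRingType) (P : {pred A}) : Prop :=
  idealr_closed P /\ prime_idealr_closed P.

Definition prime_chain (A : comNzRingType) (d : nat) (P : nat -> {pred A}) :=
  (forall i, (i <= d)%N -> prime_ideal (P i)) /\
  (forall i, (i < d)%N ->
     {subset P i <= P i.+1} /\ ~ {subset P i.+1 <= P i}).

(* The Krull dimension of A is finite and equal to d. *)
Definition krull_dim_is (A : comNzRingType) (d : nat) : Prop :=
  (exists P : nat -> {pred A}, prime_chain d P) /\
  (forall e (P : nat -> {pred A}), prime_chain e P -> (e <= d)%N).

Definition analytic_spread_is (k : fieldType) (N : nat)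
    (I : {pred {mpoly k[N]}}) (l : nat) : Prop :=
  krull_dim_is (fiber_cone I) l.

Record sgraph (V : finType) := SGraph {
  edge :> rel V;
  edge_sym : ssrbool.symmetric edge;
  edge_irrefl : irreflexive edge
}.

(* The vertices x_v and y_v of the whiskering are inl v and inr v. *)
Definition whisker_edge (V : finType) (G : sgraph V) : rel (V + V)%type :=
  fun a b => match a, b with
  | inl u, inl v => G u v
  | inl u, inr v | inr u, inl v => u == v
  | inr _, inr _ => false
  end.

Lemma whisker_edge_sym (V : finType) (G : sgraph V) :
  ssrbool.symmetric (whisker_edge G).
Proof. by case=> u [] v //=; rewrite ?(edge_sym G u v) // eq_sym. Qed.

Lemma whisker_edge_irrefl (V : finType) (G : sgraph V) :
  irreflexive (whisker_edge G).
Proof. by case=> u //=; apply: edge_irrefl. Qed.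

Definition whiskering (V : finType) (G : sgraph V) : sgraph (V + V)%type :=
  SGraph (whisker_edge_sym G) (whisker_edge_irrefl G).

Definition vertex_var (k : fieldType) (V : finType) (v : V) : {mpoly k[#|V|]} :=
  'X_(enum_rank v).

Definition cover_ideal (k : fieldType) (V : finType) (H : sgraph V) :
    {pred {mpoly k[#|V|]}} := fun p =>
  [forall u, forall v, H u v ==>
     (p \in ideal_gen (mem [:: vertex_var k u; vertex_var k v]))].
Arguments cover_ideal k {V} H _.

(* Main.v *)
(* Modulo the maximal ideal, [I ^ j] only keeps the monomials in which the
   exponents of [x_v] and [y_v] add up to [j] for every [v]: a vertex cover of
   the whiskering with multiplicity at least two on some whisker still is a
   cover after one vertex of that whisker is removed.  So the fiber cone is
   spanned by monomials depending on [n + 1] exponents.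

   Upper bound: elements [b i] of [P i.+1] outside [P i], for a chain of primes
   [P], are algebraically independent over [k] modulo [P 0]; but [n + 2]
   elements of the fiber cone are dependent, since the products of their powers
   of exponent less than [r] number [r ^ (n + 2)] and lie in a space of
   dimension [O(r ^ (n + 1))].

   Lower bound: setting [x_v = 1] sends the covers [V] and [V - v + y_v] to [s]
   and [s * y_v] in a polynomial ring in [n + 1] variables; killing the
   variables [y_v], then [s], one after the other gives a strict chain of
   [n + 2] primes. *)
Require Import Defs.
From HB Require Import structures.
From mathcomp Require Import all_boot all_algebra.
From mathcomp Require Import ring_quotient boolp mpoly.

Set Implicit Arguments.
Unset Strict Implicit.
Unset Printing Implicit Defensive.
Import GRing.Theory.
Local Open Scope ring_scope.

(** * Monomials of the powers of a cover ideal *)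

Section MonomialIdeals.
Variables (k : fieldType) (N : nat).
Local Notation R := {mpoly k[N]}.

(** The polynomials supported on an upward closed set [Q] of monomials form an ideal, so [Q] has to
    be checked on the generators only. *)
Lemma msupp_ideal_gen (S : {pred R}) (Q : 'X_{1..N} -> Prop) :
  (forall m m', Q m -> Q (m' + m)%MM) ->
  (forall p, p \in S -> forall m, m \in msupp p -> Q m) ->
  forall p, p \in ideal_gen S -> forall m, m \in msupp p -> Q m.
Proof.
move=> QD SQ p Sp; apply/asboolP.
suff: p \in [pred p : R | `[< forall m, m \in msupp p -> Q m >]] by [].
apply: ideal_gen_min Sp => [|p1 p2|a p1|p1 Sp1]; rewrite !inE.
- by apply/asboolP => m; rewrite msupp0.
- move=> /asboolP Q1 /asboolP Q2; apply/asboolP => m /msuppD_le.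
  by rewrite mem_cat => /orP[/Q1|/Q2].
- move=> /asboolP Q1; apply/asboolP => m /msuppM_le /allpairsP[[m1 m2] /=].
  by case=> _ /Q1 Qm2 ->; apply: QD.
by apply/asboolP; apply: SQ.
Qed.

Lemma ideal_gen_msupp (S : {pred R}) (p : R) :
  (forall m, m \in msupp p -> 'X_[m] \in ideal_gen S) -> p \in ideal_gen S.
Proof.
move=> Sp; rewrite (mpolyE p) big_seq; apply: ideal_gen_sum => m /Sp Sm.
by rewrite -mul_mpolyC; apply: ideal_genM.
Qed.

Lemma mem_hmax_ideal (m : 'X_{1..N}) i :
  (0 < m i)%N -> ('X_[m] : R) \in @hmax_ideal k N.
Proof.
rewrite lt0n -lep1mP => /submK <-; rewrite mpolyXD.
apply/ideal_genM/mem_ideal_gen.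
by apply/existsP; exists i.
Qed.

Lemma hmax_ideal_mdeg (p : R) m :
  p \in @hmax_ideal k N -> m \in msupp p -> (0 < mdeg m)%N.
Proof.
move=> mp.
apply: (msupp_ideal_gen (Q := fun m => (0 < mdeg m)%N) _ _ mp) => {mp}.
  by move=> m1 m2; rewrite mdegD => /ltn_addl->.
by move=> _ /existsP[i /eqP->] m1; rewrite msuppX inE => /eqP->; rewrite mdeg1.
Qed.

End MonomialIdeals.

Section Covers.
Variables (k : fieldType) (V : finType) (H : sgraph V).
Local Notation N := #|V|.
Local Notation R := {mpoly k[N]}.
Implicit Types (m c : 'X_{1..N}) (p q : R).

Definition vertex_cover m :=
  forall u v, H u v -> (0 < m (enum_rank u))%N || (0 < m (enum_rank v))%N.

(** These are the exponents of the monomials in the [j]-th power of the cover ideal; for [j = 0]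
    this is the unit ideal, hence [True]. *)
Fixpoint cover_sum j m : Prop :=
  if j is i.+1 then
    exists c m', [/\ vertex_cover c, cover_sum i m' & m = (c + m')%MM]
  else True.

Lemma coverD m c : vertex_cover c -> vertex_cover (m + c)%MM.
Proof.
by move=> Hc u v /Hc; rewrite !mnmDE => /orP[]/ltn_addl->; rewrite ?orbT.
Qed.

Lemma cover_sumD j m m' : cover_sum j m -> cover_sum j (m' + m)%MM.
Proof.
case: j => //= j [c [m1 [Hc Hm ->]]]; exists (m' + c)%MM, m1.
by split=> //; [apply: coverD|rewrite addmA].
Qed.

Lemma cover_ideal_cover p m :
  p \in cover_ideal k H -> m \in msupp p -> vertex_cover m.
Proof.
move=> /forallP Jp mp u v Huv.
have /implyP/(_ Huv) Iuv := forallP (Jp u) v.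
pose Q m := (0 < m (enum_rank u))%N || (0 < m (enum_rank v))%N.
apply: (msupp_ideal_gen (Q := Q) _ _ Iuv mp); rewrite /Q.
  by move=> m1 m2; rewrite !mnmDE => /orP[]/ltn_addl->; rewrite ?orbT.
move=> q; rewrite !inE => /orP[]/eqP-> m1; rewrite msuppX inE => /eqP->.
  by rewrite mnm1E eqxx.
by rewrite !mnm1E eqxx orbT.
Qed.

Lemma mem_cover_ideal m : vertex_cover m -> ('X_[m] : R) \in cover_ideal k H.
Proof.
move=> Hm; apply/forallP => u; apply/forallP => v; apply/implyP => /Hm.
by case/orP; rewrite lt0n -lep1mP => /submK <-; rewrite mpolyXD;
  apply/ideal_genM/mem_ideal_gen; rewrite !inE eqxx ?orbT.
Qed.

Lemma cover_ideal_exp_sum j p m :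
  p \in ideal_exp (cover_ideal k H) j -> m \in msupp p -> cover_sum j m.
Proof.
elim: j p m => [//|j IHj] p m Jp mp.
apply: (msupp_ideal_gen (Q := cover_sum j.+1) _ _ Jp mp) => {Jp mp}.
  exact: (@cover_sumD j.+1).
move=> _ /asboolP[a [b [Ja Jb ->]]] m1 /msuppM_le /allpairsP[[c m']  /=].
case=> ca m'b ->; exists c, m'; split=> //; last exact: IHj m'b.
exact: cover_ideal_cover ca.
Qed.

Lemma mem_cover_ideal_exp j m :
  cover_sum j m -> ('X_[m] : R) \in ideal_exp (cover_ideal k H) j.
Proof.
elim: j m => [//|j IHj] m /= [c [m' [Hc Hm' ->]]].
by rewrite mpolyXD; apply: mem_ideal_mul; [apply: mem_cover_ideal|apply: IHj].
Qed.

End Covers.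

(** * Balanced monomials of a whiskering *)

Section Whiskering.
Variables (k : fieldType) (V : finType) (G : sgraph V).
Local Notation H := (whiskering G).
Local Notation N := #|{: V + V}|.
Local Notation R := {mpoly k[N]}.
Local Notation J := (cover_ideal k H).
Local Notation x v := (enum_rank (inl v : V + V)).
Local Notation y v := (enum_rank (inr v : V + V)).
Implicit Types (m c : 'X_{1..N}) (p q : R).

Lemma cover_pair c v : vertex_cover H c -> (0 < c (x v) + c (y v))%N.
Proof.
by move=> /(_ (inl v) (inr v) (eqxx v)); rewrite addn_gt0.
Qed.

Lemma mdeg_pairs m : mdeg m = (\sum_v (m (x v) + m (y v)))%N.
Proof.
rewrite mdegE (reindex (@enum_rank {: V + V})) /=; last first.
  by apply: onW_bij; apply: enum_rank_bij.
by rewrite big_sumType big_split.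
Qed.

Lemma cover_sum_mdeg j m : cover_sum H j m -> (#|V| * j <= mdeg m)%N.
Proof.
elim: j m => [|j IHj] m; first by rewrite muln0.
case=> c [m' [Hc Hm' ->]]; rewrite mdegD mulnS leq_add ?IHj //.
rewrite mdeg_pairs -sum1_card; apply: leq_sum => v _; exact: cover_pair.
Qed.

Definition balanced j m := [forall v, m (x v) + m (y v) == j]%N.

(** If [y_v] is absent, [x_v] has exponent at least two and lowering it keeps the support. Otherwise
    lower [y_v]: its only edge is the whisker, which keeps a positive total. *)
Lemma cover_shrink c v : vertex_cover H c -> (1 < c (x v) + c (y v))%N ->
  exists c' i, vertex_cover H c' /\ c = (U_(i) + c')%MM.
Proof.
move=> Hc c2.
have [y0|y_gt0] := posnP (c (y v)).
  exists (c - U_(x v))%MM, (x v); split; last first.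
    by rewrite addmC submK // lep1mP; move: c2; rewrite y0; case: (c _).
  move: c2; rewrite y0 addn0 => x2 a b Hab; have := Hc a b Hab.
  rewrite !mnmBE !mnm1E.
  have pos w : (0 < c w)%N -> (0 < c w - (x v == w))%N.
    by case: eqP => [<- _|_]; rewrite ?subn0 // subn_gt0.
  by case/orP=> /pos ->; rewrite ?orbT.
exists (c - U_(y v))%MM, (y v); split; last first.
  by rewrite addmC submK // lep1mP -lt0n.
move=> a b Hab.
have yv i : (c - U_(y v))%MM (enum_rank (inl i : V + V)) = c (x i).
  by rewrite mnmBE mnm1E (inj_eq enum_rank_inj) subn0.
have yy i : (c - U_(y v))%MM (y i) = (c (y i) - (v == i))%N.
  by rewrite mnmBE mnm1E (inj_eq enum_rank_inj).
have := Hc _ _ Hab.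
case: a b Hab => a [] b //= Hab; rewrite ?yv ?yy //.
  rewrite -(eqP Hab) [v == a]eq_sym.
  case: eqP => [->|_]; rewrite ?subn0 // => _.
  by rewrite subn_gt0; move: c2; case: (c _); case: (c _) => [|[]].
rewrite (eqP Hab) [v == b]eq_sym; case: eqP => [->|_]; rewrite ?subn0 // => _.
by move: c2 y_gt0; case: (c (x v)); case: (c (y v)) => [|[]].
Qed.

Lemma unbalanced_mem j m : cover_sum H j m -> ~~ balanced j m ->
  ('X_[m] : R) \in ideal_mul (@hmax_ideal k N) (ideal_exp J j).
Proof.
elim: j m => [|j IHj] m.
  move=> _ /forallPn[v]; rewrite addn_eq0 negb_and -!lt0n => m_v.
  rewrite -['X_[m]]mulr1; apply: mem_ideal_mul => //.
  by case/orP: m_v => m_v; apply: mem_hmax_ideal m_v.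
case=> c [m' [Hc Hm' ->]] nb; rewrite mpolyXD.
(* If [m'] is already unbalanced, the induction hypothesis supplies the factor in the maximal ideal,
   and multiplying by the cover [c] raises the power by one. *)
have [b|/(IHj _ Hm')] := boolP (balanced j m'); last first.
  set q := 'X_[m'] => Iq.
  suff: q \in [pred q : R | 'X_[c] * q \in
      ideal_mul (@hmax_ideal k N) (ideal_exp J j.+1)] by [].
  apply: ideal_gen_min Iq => [|u v|a u|_ /asboolP[a [b [ma Ib ->]]]];
    rewrite !inE.
  - by rewrite mulr0 ideal_gen0.
  - by rewrite mulrDr; apply: ideal_genD.
  - by rewrite mulrCA; apply: ideal_genM.
  rewrite mulrCA; apply: mem_ideal_mul => //.
  by apply: mem_ideal_mul => //; apply: mem_cover_ideal.
(* With [m'] balanced, [c] must cause the imbalance: its total on some whisker differs from 1 and is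
   positive. *)
have [v c_v] : exists v, (1 < c (x v) + c (y v))%N.
  have /forallPn[v nbv] := nb; exists v.
  rewrite ltn_neqAle (cover_pair v Hc) andbT eq_sym.
  move/forallP/(_ v)/eqP: b => b.
  by apply: contraNneq nbv => e; rewrite !mnmDE addnACA e b.
have [c' [i [Hc' ->]]] := cover_shrink Hc c_v.
rewrite mpolyXD -mulrA; apply: mem_ideal_mul.
  by apply: (@mem_hmax_ideal _ _ _ i); rewrite mnm1E eqxx.
by apply: mem_ideal_mul; [apply: mem_cover_ideal|apply: mem_cover_ideal_exp].
Qed.

(** Only unbalanced monomials remain, and each lies in the ideal. Vanishing in the fiber cone thus
    follows from linear conditions on coefficients. *)
Lemma mem_fiber_ideal (p : rees J) :
  (forall j m, balanced j m -> ((val p)`_j)@_m = 0) ->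
  p \in fiber_ideal (I := J).
Proof.
move=> p0; apply/asboolP => j; apply: ideal_gen_msupp => m mp.
have /asboolP/(_ j) Jp := valP p.
apply: unbalanced_mem; first exact: cover_ideal_exp_sum Jp mp.
by apply: contraTN mp => /p0 /eqP; rewrite mcoeff_eq0.
Qed.

End Whiskering.

(** * Chains of primes are no longer than the transcendence degree *)

Section ChainIndependence.
Variables (k : fieldType) (r : nat).

(** The exponents are the [d] lowest base [r] digits of [a], so that [a < r ^ d] enumerates all
    exponent vectors with entries below [r]. *)
Fixpoint digit_monomial (A : comNzRingType) (b : nat -> A) d a : A :=
  if d is e.+1 then
    b 0%N ^+ (a %% r)%N * digit_monomial (fun i => b i.+1) e (a %/ r)%N
  else 1.

Lemma rmorph_digit_monomial (A B : comNzRingType) (f : {rmorphism A -> B})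
    b d a :
  f (digit_monomial b d a) = digit_monomial (fun i => f (b i)) d a.
Proof.
elim: d b a => [|d IHd] b a /=; first by rewrite rmorph1.
by rewrite rmorphM rmorphXn IHd.
Qed.

Lemma sum_digits (A : comNzRingType) s (F : nat -> A) : (0 < r)%N ->
  \sum_(a < (r * s)%N) F a = \sum_(i < r) \sum_(q < s) F (q * r + i)%N.
Proof.
move=> r_gt0; rewrite exchange_big /= mulnC.
elim: s => [|s IHs]; first by rewrite !big_ord0.
rewrite big_ord_recr /= -IHs mulSnr.
by rewrite big_split_ord /=.
Qed.

Variable A : comNzRingType.

(** Modulo [Q] only the constant term of the relation survives, so [X 0] lies in [Q] and vanishes.
    Then [b] cancels modulo the prime [P], and the argument repeats on the shifted coefficients. *)
Lemma prime_peel (P Q : {pred A}) (b : A) s (X : nat -> A) :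
  prime_ideal P -> prime_ideal Q -> {subset P <= Q} -> b \notin P -> b \in Q ->
  \sum_(i < s) b ^+ i * X i \in P ->
  (forall i, (i < s)%N -> X i \in Q -> X i = 0) ->
  forall i, (i < s)%N -> X i = 0.
Proof.
move=> [[P0 _ PD] PM] [[Q0 _ QD] QM] PQ bP bQ.
elim: s X => [//|s IHs] X.
rewrite big_ord_recl expr0 mul1r => PX X0.
set Y := \sum_(i < s) b ^+ i * X i.+1.
have eY : \sum_(i < s) b ^+ lift ord0 i * X (lift ord0 i) = b * Y.
  by rewrite mulr_sumr; apply: eq_bigr => i _; rewrite lift0 exprS mulrA.
rewrite eY in PX.
have X00 : X 0%N = 0.
  apply: (X0 0%N isT); have -> : X 0%N = (- Y) * b + (X 0%N + b * Y).
    by rewrite mulNr addrC mulrC addrK.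
  exact: QD (- Y) _ _ bQ (PQ _ PX).
rewrite X00 add0r in PX.
have PY : Y \in P by case/orP: (PM _ _ PX) => // /idPn[].
by case=> // i; apply: (IHs (fun i => X i.+1) PY (fun i => X0 i.+1)).
Qed.

(* The lexicographically least monomial of a relation modulo [P 0] would have
   a coefficient in [P d]: the factors [b i] can be cancelled modulo [P i]
   and the remaining terms vanish modulo [P i.+1]. *)
Lemma prime_chain_independent (f : {rmorphism k -> A}) d (P : nat -> {pred A})
    b (c : nat -> k) :
  (0 < r)%N -> (forall i, (i <= d)%N -> prime_ideal (P i)) ->
  (forall i, (i < d)%N ->
     [/\ {subset P i <= P i.+1}, b i \notin P i & b i \in P i.+1]) ->
  \sum_(a < (r ^ d)%N) f (c a) * digit_monomial b d a \in P 0%N ->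
  forall a, (a < r ^ d)%N -> c a = 0.
Proof.
move=> r_gt0; elim: d P b c => [|d IHd] P b c Pprime Pb.
  rewrite expn0 big_ord1 /= mulr1 => Pc [] // _; apply/eqP/negPn/negP => c0.
  have [[P0 /negP P1 PD] _] := Pprime 0%N isT; apply: P1.
  by rewrite -(rmorph1 f) -(mulVf c0) rmorphM -[_ * _]addr0 PD.
(* [X i] is the coefficient of [b 0 ^+ i], collecting the indices with lowest digit [i]. *)
pose X i := \sum_(q < (r ^ d)%N)
  f (c (q * r + i)%N) * digit_monomial (fun i => b i.+1) d q.
rewrite expnS (sum_digits _ (fun a => f (c a) * digit_monomial b d.+1 a)) //.
move=> PX.
have [PS bP bPS] := Pb 0%N isT.
have eX : \sum_(i < r) b 0%N ^+ i * X i \in P 0%N.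
  suff <- : \sum_(i < r) \sum_(q < (r ^ d)%N)
      f (c (q * r + i)%N) * digit_monomial b d.+1 (q * r + i)%N
    = \sum_(i < r) b 0%N ^+ i * X i by [].
  apply: eq_bigr => i _; rewrite mulr_sumr.
  apply: eq_bigr => q _ /=.
  by rewrite divnMDl // divn_small // addn0 modnMDl modn_small // mulrCA.
have cX i : (i < r)%N -> X i \in P 1%N -> forall q, (q < r ^ d)%N ->
    c (q * r + i)%N = 0.
  move=> _; apply: (IHd (fun i => P i.+1) _ (fun q => c (q * r + i)%N)) => j.
    exact: (Pprime j.+1).
  exact: (Pb j.+1).
have X0 := prime_peel (Pprime 0%N isT) (Pprime 1%N isT) PS bP bPS eX.
move=> a a_lt; rewrite (divn_eq a r); apply: (cX).
- by rewrite ltn_mod.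
- have [[Z1 _ _] _] := Pprime 1%N isT; rewrite X0 ?ltn_mod //.
  move=> i i_lt /(cX _ i_lt) c0; rewrite /X big1 // => q _.
  by rewrite c0 // rmorph0 mul0r.
by rewrite ltn_divLR // mulnC.
Qed.

End ChainIndependence.

(** * Dimension count and the upper bound *)

Lemma left_kernel_nontrivial (F : fieldType) m n (M : 'M[F]_(m, n)) :
  (n < m)%N -> exists2 u : 'rV_m, u != 0 & u *m M = 0.
Proof.
move=> lt_nm; have : kermx M != 0.
  rewrite kermx_eq0 /row_free neq_ltn.
  by rewrite (leq_ltn_trans (rank_leq_col M) lt_nm).
by case/rowV0Pn=> u /sub_kermxP uM u0; exists u.
Qed.

Section ReesConstants.
Variables (k : fieldType) (N : nat) (I : {pred {mpoly k[N]}}).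

Lemma rees_const_subproof (c : k) :
  (c%:MP%:P : {poly {mpoly k[N]}}) \in rees_pred I.
Proof.
apply/asboolP => i; rewrite coefC; case: eqP => [->//|_].
by have [] := ideal_exp_ideal I i.
Qed.

Definition rees_const (c : k) : rees I := Rees (rees_const_subproof c).

Lemma rees_const_zmod_morphism : zmod_morphism rees_const.
Proof. by move=> c d; apply: val_inj; rewrite /= !rmorphB. Qed.

Lemma rees_const_monoid_morphism : monoid_morphism rees_const.
Proof. by split=> [|c d]; apply: val_inj; rewrite /= ?rmorph1 ?rmorphM. Qed.

HB.instance Definition _ :=
  GRing.isZmodMorphism.Build k (rees I) rees_const rees_const_zmod_morphism.
HB.instance Definition _ :=
  GRing.isMonoidMorphism.Build k (rees I) rees_const rees_const_monoid_morphism.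

Lemma size_digit_monomial r D d (b : nat -> rees I) a : (0 < r)%N ->
  (forall i, (i < d)%N -> (size (val (b i)) <= D.+1)%N) ->
  (size (val (digit_monomial r b d a)) <= (d * r * D).+1)%N.
Proof.
move=> r_gt0; elim: d b a => [|d IHd] b a bD.
  by rewrite [digit_monomial _ _ _ _]/= rmorph1 size_poly1.
rewrite [digit_monomial _ _ _ _]/= rmorphM rmorphXn.
apply: leq_trans (size_polyMleq _ _) _.
have h1 : (size (val (b 0%N) ^+ (a %% r)%N) <= (r * D).+1)%N.
  apply: leq_trans (size_poly_exp_leq _ _) _; rewrite ltnS mulnC leq_mul //.
    by rewrite ltnW ?ltn_mod.
  by have := bD 0%N isT; case: (size _).
have h2 := IHd (fun i => b i.+1) (a %/ r)%N (fun i => bD i.+1).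
rewrite -subn1 leq_subLR; apply: leq_trans (leq_add h1 h2) _.
by rewrite mulSn mulnDl addSn addnS add1n.
Qed.

End ReesConstants.

Local Open Scope quotient_scope.

Section UpperBound.
Variables (k : fieldType) (V : finType) (G : sgraph V).
Local Notation J := (cover_ideal k (whiskering G)).
Local Notation N := #|{: V + V}|.
Local Notation Q := {ideal_quot fiber_ideal (I := J)}.
Local Notation x v := (enum_rank (inl v : V + V)).
Local Notation y v := (enum_rank (inr v : V + V)).

(** A balanced monomial is determined by its exponents [f v] at the [y_v]. Where [f v] exceeds [j]
    the subtraction truncates; such monomials merely add conditions to the count. *)
Definition balanced_mnm M (f : {ffun V -> 'I_M}) j : 'X_{1..N} :=
  [multinom match enum_val i with
            | inl v => j - f v
            | inr v => f v
            end | i < N]%N.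

Lemma balanced_mnmP M j m : (j < M)%N -> balanced j m ->
  exists f : {ffun V -> 'I_M}, m = balanced_mnm f j.
Proof.
move=> jM /forallP bm.
have lt_m v : (m (y v) < M)%N.
  by apply: leq_ltn_trans jM; rewrite -(eqP (bm v)) leq_addl.
exists [ffun v => Ordinal (lt_m v)]; apply/mnmP => i; rewrite mnmE.
rewrite -[i in LHS]enum_valK; case: (enum_val i) => v; rewrite ffunE //=.
by rewrite -(eqP (bm v)) addnK.
Qed.

Lemma mem_fiber_ideal_bounded M (p : rees J) : (size (val p) <= M)%N ->
  (forall (j : 'I_M) (f : {ffun V -> 'I_M}),
     ((val p)`_j)@_(balanced_mnm f j) = 0) ->
  p \in fiber_ideal (I := J).
Proof.
move=> pM p0; apply: mem_fiber_ideal => j m bm.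
have [jM|Mj] := ltnP j M; last by rewrite nth_default ?mcoeff0 ?(leq_trans pM).
by have [f ->] := balanced_mnmP jM bm; apply: (p0 (Ordinal jM)).
Qed.

Lemma fiber_dependent d (b : nat -> rees J) : (#|V|.+1 < d)%N ->
  exists r (c : nat -> k), [/\ (0 < r)%N,
    exists2 a, (a < r ^ d)%N & c a != 0 &
    \sum_(a < (r ^ d)%N) rees_const J (c a) * digit_monomial r b d a
      \in fiber_ideal (I := J)].
Proof.
move=> d_gt.
pose D := (\max_(i < d) size (val (b i)))%N.
(* The products have size at most [d * r * D + 1 <= M]. With [n = #|V|], there are
   [M ^ n.+1 = r ^ n.+1 * K ^ n.+1] conditions, fewer than [r ^ n.+2 <= r ^ d] because
   [K ^ n.+1 < r]. *)
pose K := (d * D).+1; pose r := (K ^ #|V|.+1).+1; pose M := (r * K)%N.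
have r_gt0 : (0 < r)%N by [].
pose T := ('I_M * {ffun V -> 'I_M})%type.
have lt_T : (#|{: T}| < r ^ d)%N.
  rewrite card_prod card_ord card_ffun card_ord -expnS /M expnMn.
  apply: leq_trans (leq_pexp2l r_gt0 d_gt); rewrite [(r ^ _.+2)%N]expnSr.
  by rewrite ltn_pmul2l ?expn_gt0.
pose mon a := val (digit_monomial r b d a).
(* Rows are the products and columns the balanced coefficients, so a left kernel vector is a
   relation in the fiber cone. *)
pose E := \matrix_(a < r ^ d, t < #|{: T}|)
  ((mon a)`_(enum_val t).1)@_(balanced_mnm (enum_val t).2 (enum_val t).1).
have [u u0 uE] := left_kernel_nontrivial E lt_T.
pose c a := oapp (u 0) 0 (insub a : option 'I_(r ^ d)%N).
have cE (a : 'I_(r ^ d)%N) : c a = u 0 a by rewrite /c valK.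
exists r, c; split=> //.
  have /rV0Pn[a ua] := u0; exists a => //; by rewrite cE.
have vE : val (\sum_(a < (r ^ d)%N) rees_const J (c a) * digit_monomial r b d a)
    = \sum_(a < (r ^ d)%N) (c a)%:MP%:P * mon a.
  by rewrite rmorph_sum; apply: eq_bigr => a _; rewrite rmorphM.
apply: (@mem_fiber_ideal_bounded M).
  rewrite vE; apply: (big_ind (fun p : {poly _} => size p <= M)%N).
  - by rewrite size_poly0.
  - move=> p q p_le q_le.
    by rewrite (leq_trans (size_polyD _ _)) ?geq_max ?p_le.
  move=> a _; rewrite mul_polyC (leq_trans (size_scale_leq _ _)) //.
  apply: leq_trans (size_digit_monomial (D := D) a r_gt0 _) _.
    by move=> i i_lt; apply/leqW/(leq_bigmax (Ordinal i_lt)).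
  by rewrite /M /K mulnS mulnAC mulnC addnC -addn1 leq_add2l.
move=> j f; rewrite vE coef_sum raddf_sum /=.
have := congr1 (fun v : 'rV_#|{: T}| => v 0 (enum_rank (j, f))) uE.
rewrite !mxE => E0; rewrite -[RHS]E0; apply: eq_bigr => a _.
by rewrite mxE enum_rankK /= coefCM mcoeffCM cE.
Qed.

Lemma fiber_cone_chain_bound e (P : nat -> {pred fiber_cone J}) :
  prime_chain e P -> (e <= #|V|.+1)%N.
Proof.
move=> [Pprime Plt]; rewrite leqNgt; apply/negP => e_gt.
(* Strictness of the chain gives a class in [P i.+1] outside [P i], lifted to the Rees algebra; 0 is
   a default value from [e] on. *)
have bP i : exists z : rees J, (i < e)%N ->
    \pi_Q z \notin P i /\ \pi_Q z \in P i.+1.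
  have [i_lt|_] := ltnP i e; last by exists 0.
  have [_ nP] := Plt i i_lt; apply: contrapT => /forallNP nz; apply: nP => z Pz.
  apply/negPn/negP => nPz; apply: (nz (repr (z : Q))) => _.
  by rewrite !reprK.
have [b bP'] := choice bP.
have [r [c [r_gt0 [a a_lt ca] sum0]]] := fiber_dependent b e_gt.
move/eqP: ca; apply.
pose pik := (\pi_Q \o rees_const J : {rmorphism k -> Q}).
apply: (prime_chain_independent (f := pik) (P := P)
  (b := fun i => \pi_Q (b i))) a_lt => //.
  by move=> i i_lt; have [PP _] := Plt i i_lt; have [] := bP' i i_lt.
have -> : \sum_(a < (r ^ e)%N) pik (c a) *
     digit_monomial r (fun i => \pi_Q (b i)) e a
   = \pi_Q (\sum_(a < (r ^ e)%N) rees_const J (c a) * digit_monomial r b e a).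
  rewrite rmorph_sum; apply: eq_bigr => i _.
  by rewrite rmorphM rmorph_digit_monomial.
have -> : \pi_Q (\sum_(a < (r ^ e)%N)
    rees_const J (c a) * digit_monomial r b e a) = 0 :> Q.
  rewrite -(rmorph0 \pi_Q); apply/eqP.
  by rewrite -Quotient.idealrBE subr0.
by have [[]] := Pprime 0%N isT.
Qed.

End UpperBound.

(** * A chain of length n + 1 *)

(** This makes the passage to initial forms multiplicative. *)
Lemma coefM_initial (A : comNzRingType) (f g : {poly A}) a b :
  (forall i, (i < a)%N -> f`_i = 0) -> (forall i, (i < b)%N -> g`_i = 0) ->
  (f * g)`_(a + b) = f`_a * g`_b.
Proof.
move=> f0 g0; rewrite coefM.
have a_lt : (a < (a + b).+1)%N by rewrite ltnS leq_addr.
rewrite (bigD1 (Ordinal a_lt)) //= addKn big1 ?addr0 // => i.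
rewrite -val_eqE neq_ltn /= => /orP[i_lt|a_lti]; first by rewrite f0 ?mul0r.
by rewrite [g`__]g0 ?mulr0 // ltn_subLR ?ltn_add2r // -ltnS.
Qed.

Section InitialForm.
Variables (k : fieldType) (V : finType) (G : sgraph V).
Local Notation n := #|V|.
Local Notation N := #|{: V + V}|.
Local Notation R := {mpoly k[N]}.
Local Notation T := {mpoly k[n.+1]}.
Local Notation J := (cover_ideal k (whiskering G)).

(** The indices below [n] hold the variables [y_v]; the last one, [ord_max], is reserved for [s]. *)
Definition whisker_weight (a : V + V) : T :=
  if a is inr v then 'X_(inord (enum_rank v)) else 1.

(* The exponent of the new variable is the degree, so that the coefficient of
   lowest degree is the initial form, dehomogenised at the [x_v]. It is
   packed with its specification to keep unification from unfolding it. *)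
Fact grading_key : {f : {rmorphism R -> {poly T}} | forall c m,
  f (c *: 'X_[m]) =
    (c%:MP * \prod_i whisker_weight (enum_val i) ^+ m i) *: 'X^(mdeg m)}.
Proof.
exists (mmap (polyC \o @mpolyC _ _)
  (fun i => whisker_weight (enum_val i) *: 'X)).
move=> c m; rewrite /= mmapZ mmapX /mmap1 mdegE /=.
under eq_bigr => i _ do rewrite exprZn.
by rewrite scaler_prod prodrXr mul_polyC scalerA.
Qed.

Definition grading : {rmorphism R -> {poly T}} := sval grading_key.

Lemma gradingZX c m : grading (c *: 'X_[m]) =
  (c%:MP * \prod_i whisker_weight (enum_val i) ^+ m i) *: 'X^(mdeg m).
Proof. exact: (svalP grading_key). Qed.

Lemma grading_low (p : R) i :
  (forall m, m \in msupp p -> (i < mdeg m)%N) -> (grading p)`_i = 0.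
Proof.
move=> p_lt; rewrite [p]mpolyE rmorph_sum coef_sum big_seq.
rewrite big1 // => m /p_lt lt_m.
by rewrite gradingZX coefZ coefXn ltn_eqF ?mulr0.
Qed.

Lemma grading_exp j (p : R) i :
  p \in ideal_exp J j -> (i < n * j)%N -> (grading p)`_i = 0.
Proof.
move=> Jp i_lt; apply: grading_low => m /(cover_ideal_exp_sum Jp).
by move/cover_sum_mdeg; apply: leq_trans.
Qed.

(** Covers have degree at least [n], so a factor in the maximal ideal pushes the degree above
    [n * j]. Hence initial forms factor through the fiber cone. *)
Lemma grading_hmax_exp j (p : R) :
  p \in ideal_mul (@hmax_ideal k N) (ideal_exp J j) -> (grading p)`_(n * j) = 0.
Proof.
move=> mp; apply: grading_low => m.
apply: (msupp_ideal_gen (Q := fun m => (n * j < mdeg m)%N)) mp m.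
  by move=> m m'; rewrite mdegD => /ltn_addl->.
move=> _ /asboolP[a [b [ma Jb ->]]] m /msuppM_le.
move=> /allpairsP[[m1 m2] /= [m1a m2b ->]].
rewrite mdegD -addn1 addnC leq_add ?(hmax_ideal_mdeg ma) //.
exact/cover_sum_mdeg/(cover_ideal_exp_sum Jb).
Qed.

Fact initial_poly_key (p : rees J) :
  {q : {poly T} | forall j, q`_j = (grading (val p)`_j)`_(n * j)}.
Proof.
exists (\poly_(j < size (val p)) (grading (val p)`_j)`_(n * j)) => j.
rewrite coef_poly; case: ltnP => // le_j.
by rewrite (nth_default _ le_j) rmorph0 coef0.
Qed.

Definition initial_poly p := sval (initial_poly_key p).

Lemma coef_initial_poly p j :
  (initial_poly p)`_j = (grading (val p)`_j)`_(n * j).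
Proof. exact: (svalP (initial_poly_key p)). Qed.

Lemma initial_poly_zmod_morphism : zmod_morphism initial_poly.
Proof.
move=> p q; apply/polyP => j.
rewrite [RHS]coefB !coef_initial_poly.
have -> : (val (p - q))`_j = (val p)`_j - (val q)`_j by rewrite rmorphB coefB.
by rewrite [grading _]rmorphB coefB.
Qed.

Lemma initial_poly_monoid_morphism : monoid_morphism initial_poly.
Proof.
split=> [|p q]; apply/polyP => j; rewrite ?coefM !coef_initial_poly.
  rewrite rmorph1 !coef1; case: j => [|j]; first by rewrite muln0 rmorph1 coef1.
  by rewrite rmorph0 coef0.
rewrite rmorphM coefM rmorph_sum coef_sum; apply: eq_bigr => i _.
rewrite !coef_initial_poly rmorphM.
have -> : (n * j = n * i + n * (j - i))%N.
  by rewrite -mulnDr subnKC // -ltnS.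
have Jcoef (s : rees J) l : (val s)`_l \in ideal_exp J l.
  by have /asboolP/(_ l) := valP s.
by apply: coefM_initial => l; apply: grading_exp; apply: Jcoef.
Qed.

HB.instance Definition _ := GRing.isZmodMorphism.Build (rees J) {poly T}
  initial_poly initial_poly_zmod_morphism.
HB.instance Definition _ := GRing.isMonoidMorphism.Build (rees J) {poly T}
  initial_poly initial_poly_monoid_morphism.

Lemma initial_poly_fiber p : p \in fiber_ideal (I := J) -> initial_poly p = 0.
Proof.
move=> /asboolP mp; apply/polyP => j.
by rewrite coef0 coef_initial_poly grading_hmax_exp.
Qed.

(** * The chain of primes from killing variables *)

Definition kill r (i : 'I_n.+1) : T := if (i < r)%N then 0 else 'X_i.

(** The Rees variable is sent to [s], then the first [r] variables are killed, [s] being the last to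
    go. The target is a domain, so the kernels are prime. *)
Definition face_map r (p : rees J) : T :=
  (initial_poly p).['X_ord_max] \mPo [tuple kill r i | i < n.+1].

Lemma face_map_zmod_morphism r : zmod_morphism (face_map r).
Proof. by move=> p q; rewrite /face_map rmorphB hornerD hornerN rmorphB. Qed.

Lemma face_map_monoid_morphism r : monoid_morphism (face_map r).
Proof.
by split=> [|p q]; rewrite /face_map ?rmorph1 ?hornerC ?rmorph1 // rmorphM
  hornerM rmorphM.
Qed.

HB.instance Definition _ r := GRing.isZmodMorphism.Build (rees J) T
  (face_map r) (face_map_zmod_morphism r).
HB.instance Definition _ r := GRing.isMonoidMorphism.Build (rees J) T
  (face_map r) (face_map_monoid_morphism r).

Lemma face_map_fiber r p : p \in fiber_ideal (I := J) -> face_map r p = 0.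
Proof.
by move=> mp; rewrite /face_map initial_poly_fiber // horner0 rmorph0.
Qed.

(** This factorization makes the kernels increase with [r]. *)
Lemma face_mapS r p :
  face_map r.+1 p = face_map r p \mPo [tuple kill r.+1 i | i < n.+1].
Proof.
rewrite /face_map; set q := _.[_]; rewrite [q]mpolyE.
rewrite rmorph_sum [X in _ = X \mPo _]rmorph_sum rmorph_sum.
apply: eq_bigr => m _; rewrite /= !comp_mpolyZ !comp_mpolyX rmorph_prod /=.
congr (_ *: _); apply: eq_bigr => i _; rewrite rmorphXn /= !tnth_mktuple /kill.
case: ifP => [lt_ir|/negbT]; last first.
  by rewrite -leqNgt => lt_ri; rewrite ltnNge ltnW //= comp_mpolyXU
    -tnth_nth tnth_mktuple /kill ltnNge lt_ri.
case: ifP => _; first by rewrite rmorph0.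
by rewrite comp_mpolyXU -tnth_nth tnth_mktuple /kill lt_ir.
Qed.

(** For [r < n] this is the cover exchanging [x_v] for [y_v] at the vertex [v] of rank [r]; for
    [r = n] no vertex has that rank and it is the cover by all [x_v]. *)
Definition facet_mnm (r : nat) : 'X_{1..N} :=
  [multinom match enum_val i with
            | inl v => (enum_rank v : nat) != r
            | inr v => (enum_rank v : nat) == r
            end : nat | i < N].

Lemma facet_cover r : vertex_cover (whiskering G) (facet_mnm r).
Proof.
move=> a b; rewrite !mnmE !enum_rankK.
case: a b => [u|u] [v|v] //= Huv.
(* An edge missed at both ends would join the vertex of rank [r] to itself. *)
- rewrite !lt0b -negb_and; apply: contraTN Huv => /andP[/eqP eu /eqP ev].
  have -> : u = v by apply/enum_rank_inj/val_inj; rewrite /= eu ev.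
  by rewrite edge_irrefl.
- by rewrite (eqP Huv); case: eqP.
- by rewrite (eqP Huv); case: eqP.
Qed.

Lemma facet_rees r : 'X_[facet_mnm r] *: 'X \in rees_pred J.
Proof.
apply/asboolP => i; rewrite coefZ coefX.
case: eqP => [->|_]; last first.
  by rewrite mulr0; have [] := ideal_exp_ideal J i.
by rewrite mulr1 -['X_[_]]mulr1; apply: mem_ideal_mul => //;
  apply/mem_cover_ideal/facet_cover.
Qed.

Definition facet r : rees J := Rees (facet_rees r).

Lemma mdeg_facet r : mdeg (facet_mnm r) = n.
Proof.
rewrite mdeg_pairs -[RHS]sum1_card; apply: eq_bigr => v _.
by rewrite !mnmE !enum_rankK; case: eqP.
Qed.

Lemma face_map_facet r s : (s <= n)%N ->
  face_map r (facet s) =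
    (if (s < n)%N then kill r (inord s) else 1) * kill r ord_max.
Proof.
move=> s_le; rewrite /face_map.
have -> : initial_poly (facet s) =
    (if (s < n)%N then 'X_(inord s) else 1) *: 'X.
  apply/polyP => j; rewrite coef_initial_poly /= !coefZ !coefX.
  case: eqP => [->|_]; last by rewrite !mulr0 rmorph0 coef0.
  rewrite !mulr1 muln1 -['X_[_]]scale1r gradingZX mul1r.
  rewrite coefZ mdeg_facet coefXn eqxx mulr1.
  rewrite (reindex (@enum_rank {: V + V})) /=; last first.
    by apply: onW_bij; apply: enum_rank_bij.
  rewrite big_sumType /= big1 ?mul1r; last first.
    by move=> v _; rewrite enum_rankK expr1n.
  case: ltnP => s_n.
    pose v : V := enum_val (Ordinal s_n).
    rewrite (bigD1 v) //= big1 ?mulr1.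
      by rewrite mnmE !enum_rankK /= /v enum_valK eqxx.
    move=> u uv; rewrite mnmE !enum_rankK /=; case: eqP => // e.
    by case/eqP: uv; apply: enum_rank_inj; apply: val_inj; rewrite /v enum_valK.
  rewrite big1 // => u _; rewrite mnmE !enum_rankK ltn_eqF //.
  exact: leq_trans (ltn_ord _) s_n.
rewrite hornerZ hornerX rmorphM.
congr (_ * _); last by rewrite /= comp_mpolyXU -tnth_nth tnth_mktuple.
case: ifP => _; last by rewrite rmorph1.
by rewrite /= comp_mpolyXU -tnth_nth tnth_mktuple.
Qed.

Lemma kill_neq0 r i : (kill r i != 0) = (r <= i)%N.
Proof.
rewrite /kill ltnNge; case: leqP => _ /=; last by rewrite eqxx.
by rewrite -msupp_eq0 msuppX.
Qed.

Local Notation Q := {ideal_quot fiber_ideal (I := J)}.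

Definition face_prime r : {pred fiber_cone J} :=
  fun z => face_map r (repr (z : Q)) == 0.

(** The choice of [repr] is immaterial since [face_map r] vanishes on the fiber ideal. *)
Lemma mem_face_prime r p : (\pi_Q p \in face_prime r) = (face_map r p == 0).
Proof.
have /(face_map_fiber r) : repr (\pi_Q p) - p \in fiber_ideal (I := J).
  by rewrite Quotient.idealrBE reprK.
rewrite rmorphB => /subr0_eq e.
by rewrite -[LHS]/(face_map r (repr (\pi_Q p)) == 0) e.
Qed.

Lemma face_prime_prime r : prime_ideal (face_prime r).
Proof.
split; first split.
- by rewrite -(rmorph0 \pi_Q) mem_face_prime rmorph0.
- by rewrite -(rmorph1 \pi_Q) mem_face_prime rmorph1 oner_eq0.
- move=> a u v; rewrite -[a](reprK (qT := Q)).
  rewrite -[u](reprK (qT := Q)) -[v](reprK (qT := Q)).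
  rewrite -rmorphM -rmorphD !mem_face_prime rmorphD rmorphM /=.
  by move=> /eqP-> /eqP-> /=; rewrite mulr0 addr0.
move=> u v; rewrite -[u](reprK (qT := Q)) -[v](reprK (qT := Q)).
by rewrite -rmorphM !mem_face_prime rmorphM mulf_eq0.
Qed.

Lemma face_prime_chain : prime_chain n.+1 face_prime.
Proof.
split=> [r _|r r_le]; first exact: face_prime_prime.
split=> [z|].
  rewrite -[z](reprK (qT := Q)) !mem_face_prime face_mapS.
  by move=> /eqP->; rewrite rmorph0.
(* The class of [facet r] separates consecutive primes: it maps to [y_v * s] with [v] of rank [r],
   or to [s] if [r = n], and exactly the next kill makes this zero. *)
move=> /(_ (\pi_Q (facet r))); rewrite !mem_face_prime !face_map_facet //.
move: r_le; rewrite ltnS leq_eqVlt => /orP[/eqP e|r_lt].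
  rewrite e ltnn !mul1r => /(_ _)/eqP k0; have := kill_neq0 n ord_max.
  by rewrite k0 ?eqxx ?leqnn // /kill /= ltnSn.
have rE : (inord r : 'I_n.+1) = r :> nat by rewrite inordK // ltnS ltnW.
have k0 : kill r.+1 (inord r) = 0 by rewrite /kill rE ltnSn.
rewrite r_lt k0 mul0r => /(_ (eqxx 0)).
by apply/negP; rewrite mulf_neq0 ?kill_neq0 ?rE //= ltnW.
Qed.

End InitialForm.

Unset Implicit Arguments.
Local Close Scope ring_scope.

Theorem theorem5p8 (k : fieldType) (n : nat) (V : finType) (G : sgraph V)
    (hV : #|V| = n) :
  analytic_spread_is (cover_ideal k (whiskering G)) n.+1.
Proof.
rewrite -hV; split.
  by exists (@face_prime k V G); apply: face_prime_chain.
by move=> e P; apply: fiber_cone_chain_bound.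
Qed.
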